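(* Let $k\ge 2$, let $C_i=(M_i^3,\varphi_i,\xi_i,\eta_i,g_i)$, $i=1,\dots,k$, be cells and let $N=C_1-\dots-C_k$ be a manifold of sewed cells with its almost contact metric structure $(\varphi,\xi,\eta,g)$. If every cell $C_i$ is almost cosymplectic, then $N$ is an almost cosymplectic manifold. If every cell $C_i$ is almost $\alpha_0$-Kenmotsu, with the same real constant $\alpha_0\neq 0$, then $N$ is an almost $(\alpha_0/\sqrt{k})$-Kenmotsu manifold.
   Context: An almost contact metric structure on a manifold is a quadruple $(\varphi,\xi,\eta,g)$ of a $(1,1)$-tensor field (affinor) $\varphi$, a vector field $\xi$, a one-form $\eta$ and a Riemannian metric $g$ with $\varphi^2=-Id+\eta\otimes\xi$, $\eta(\xi)=1$, $g(\varphi X,\varphi Y)=g(X,Y)-\eta(X)\eta(Y)$. Its fundamental form is $\varPhi(X,Y)=g(X,\varphi Y)$. The manifold is almost cosymplectic if $d\eta=0$ and $d\varPhi=0$; it is almost $\alpha$-Kenmotsu ($\alpha\ne0$ a real constant) if $d\eta=0$ and $d\varPhi=2\alpha\,\eta\wedge\varPhi$. A cell is a 3-dimensional almost contact metric manifold $(M^3,\varphi,\xi,\eta,g)$ with $d\eta=0$. Product of cells: $M=C_1\times\dots\times C_k$ with projections $\pi_i:M\to C_i$; $D_i=\bigcap_{j\ne i}\mathrm{Ker}\,\pi_{*j}$, so $TM=D_1\oplus\dots\oplus D_k$. The lift of a vector field $X$ on $C_i$ is the unique vector field $\bar X\in\Gamma(D_i)$ with $\pi_{*i}(\bar X)=X$.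 $\bar\varphi_i$ is the $(1,1)$-tensor field on $M$ with $\bar\varphi_i\bar X=\overline{\varphi_iX}$ for lifts $\bar X$ of vector fields on $C_i$ and $\bar\varphi_i=0$ on $D_j$, $j\neq i$. Put $f=\sum_{i=1}^k\bar\varphi_i$, $\bar g=\sum_{i=1}^k\pi_i^*g_i$, $\bar\xi_i$ = the lift of $\xi_i$, $\bar\eta_i=\pi_i^*\eta_i$, $\bar\xi=(\bar\xi_1+\dots+\bar\xi_k)/\sqrt{k}$. The distribution $Im(f)\oplus\mathbb{R}\bar\xi$ on $M$ is involutive; the (maximal connected) integral submanifold $N\subset M$ of it through a point of $M$ is called a manifold of sewed cells, denoted $N=C_1-\dots-C_k$; with $\iota:N\to M$ the inclusion, it carries the almost contact metric structure $\varphi=f|_N$, $\xi=\bar\xi|_N$, $\eta=\sqrt{k}\,\iota^*\bar\eta_1$, $g=\bar g|_N$. *)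

(* Defs.v *)
From HB Require Import structures.
From mathcomp Require Import all_boot all_order all_algebra.
From mathcomp Require Import all_classical all_reals all_analysis.

Set Implicit Arguments.
Unset Strict Implicit.
Unset Printing Implicit Defensive.

Import Order.TTheory GRing.Theory Num.Theory.
Import numFieldNormedType.Exports.

Local Open Scope classical_set_scope.
Local Open Scope ring_scope.

(* Meant for [U] open and [V] finite-dimensional, where asking every
   directional derivative to be C^r is the classical notion of C^(r+1). *)
Fixpoint Cr (R : realType) (V W : normedModType R) (r : nat) (U : set V)
    (f : V -> W) : Prop :=
  if r is r'.+1 then
    (forall x, U x -> differentiable f x) /\
    (forall v, Cr r' U (fun x => 'D_v f x))
  else forall x, U x -> {for x, continuous f}.

Definition smooth_on (R : realType) (V W : normedModType R) (U : set V)
  (f : V -> W) : Prop := forall r, Cr r U f.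

(* The maps are total; only their values on [cdom] and on [cdom]'s image,
   [codm], are meaningful. *)
Record chart (R : realType) (E : normedModType R) (T : topologicalType) :=
  Chart {
    cfun :> T -> E;
    cinv : E -> T;
    cdom : set T;
    cdom_open : open cdom;
    codm_open : open (cfun @` cdom);
    cfunK : forall p, cdom p -> cinv (cfun p) = p;
    cfun_continuous : forall p, cdom p -> {for p, continuous cfun};
    cinv_continuous :
      forall x, (cfun @` cdom) x -> {for x, continuous cinv} }.

Definition codm (R : realType) (E : normedModType R) (T : topologicalType)
  (a : chart E T) : set E := a @` cdom a.

(* Smooth manifolds without boundary modelled on [E]; [E] is always a space of
   matrices below, so the dimension is that of [E].  Besides its atlas, a
   manifold comes with a choice of a chart of the atlas around each point,
   whose only role is to give coordinates on tangent spaces. *)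
Record manifold (R : realType) (E : normedModType R) := Manifold {
  msort :> topologicalType;
  m_hausdorff : hausdorff_space msort;
  m_second_countable : @second_countable msort;
  atlas : set (chart E msort);
  chart_at : msort -> chart E msort;
  atlas_chart_at : forall p, atlas (chart_at p);
  cdom_chart_at : forall p, cdom (chart_at p) p;
  atlas_smooth : forall a b, atlas a -> atlas b ->
    smooth_on (a @` (cdom a `&` cdom b)) (b \o cinv a) }.

Definition smooth_map (R : realType) (E F : normedModType R)
    (M : manifold E) (N : manifold F) (h : M -> N) : Prop :=
  continuous h /\
  forall a b, atlas a -> atlas b ->
    smooth_on (a @` (cdom a `&` h @^-1` cdom b)) (b \o h \o cinv a).

(* The tangent space at every point [p] of [M] is [E]: the vector [v : E]
   stands for the tangent vector at [p] whose components in the chart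
   [chart_at p] are [v].  Its components in a chart [a] around [p] are
   [comp_in a p v]; conversely, [comp_from a p] takes components in [a] to
   components in [chart_at p]. *)
Definition comp_in (R : realType) (E : normedModType R) (M : manifold E)
    (a : chart E M) (p : M) (v : E) : E :=
  'D_v (a \o cinv (chart_at p)) (chart_at p p).

Definition comp_from (R : realType) (E : normedModType R) (M : manifold E)
    (a : chart E M) (p : M) (v : E) : E :=
  'D_v (chart_at p \o cinv a) (a p).

Definition tangent_map (R : realType) (E F : normedModType R)
    (M : manifold E) (N : manifold F) (h : M -> N) (p : M) (v : E) : F :=
  'D_v (chart_at (h p) \o h \o cinv (chart_at p)) (chart_at p p).

Section tensor_fields.
Context {R : realType} {E : normedModType R} {M : manifold E}.

Definition local_vfield (a : chart E M) (X : M -> E) (x : E) : E :=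
  comp_in a (cinv a x) (X (cinv a x)).

Definition local_affinor (a : chart E M) (A : M -> E -> E) (x v : E) : E :=
  comp_in a (cinv a x) (A (cinv a x) (comp_from a (cinv a x) v)).

Definition local_form1 (a : chart E M) (w : M -> E -> R) (x v : E) : R^o :=
  w (cinv a x) (comp_from a (cinv a x) v).

Definition local_form2 (a : chart E M) (w : M -> E -> E -> R) (x u v : E)
    : R^o :=
  w (cinv a x) (comp_from a (cinv a x) u) (comp_from a (cinv a x) v).

Definition vector_field (X : M -> E) : Prop :=
  forall a, atlas a -> smooth_on (codm a) (local_vfield a X).

Definition affinor (A : M -> E -> E) : Prop :=
  (forall p, linear (A p)) /\
  forall a, atlas a -> forall v, smooth_on (codm a) (local_affinor a A ^~ v).

Definition one_form (w : M -> E -> R) : Prop :=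
  (forall p, scalar (w p)) /\
  forall a, atlas a -> forall v, smooth_on (codm a) (local_form1 a w ^~ v).

Definition bilinear_field (w : M -> E -> E -> R) : Prop :=
  [/\ (forall p u, scalar (w p u)),
      (forall p v, scalar (w p ^~ v)) &
      forall a, atlas a -> forall u v,
        smooth_on (codm a) (fun x => local_form2 a w x u v)].

Definition riemannian (g : M -> E -> E -> R) : Prop :=
  [/\ bilinear_field g,
      (forall p u v, g p u v = g p v u) &
      (forall p u, u != 0 -> 0 < g p u u)].

(* Exterior derivatives, computed at [p] in the chart [chart_at p], in the
   normalisation
     d w(X,Y)   = X w(Y) - Y w(X) - w([X,Y]),
     d w(X,Y,Z) = X w(Y,Z) - Y w(X,Z) + Z w(X,Y)
                  - w([X,Y],Z) + w([X,Z],Y) - w([Y,Z],X)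
   (constant vector fields of the chart commute). *)
Definition ext_d1 (w : M -> E -> R) (p : M) (u v : E) : R :=
  let a := chart_at p in
  'D_u (local_form1 a w ^~ v) (a p) - 'D_v (local_form1 a w ^~ u) (a p).

Definition ext_d2 (w : M -> E -> E -> R) (p : M) (u v z : E) : R :=
  let a := chart_at p in
  'D_u (fun x => local_form2 a w x v z) (a p)
  - 'D_v (fun x => local_form2 a w x u z) (a p)
  + 'D_z (fun x => local_form2 a w x u v) (a p).

(* The wedge product in the normalisation matching [ext_d2]; with the other
   usual one, both sides of d Phi = 2 alpha eta /\ Phi get a factor 1/3. *)
Definition wedge12 (w : M -> E -> R) (f : M -> E -> E -> R) (p : M)
    (u v z : E) : R :=
  w p u * f p v z - w p v * f p u z + w p z * f p u v.

End tensor_fields.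

(* Only the four tensor fields; the identities relating them are
   [almost_contact_metric]. *)
Record acm_data (R : realType) (E : normedModType R) (M : manifold E) :=
  AcmData {
    phi : M -> E -> E;
    xi : M -> E;
    eta : M -> E -> R;
    met : M -> E -> E -> R;
    phi_affinor : affinor phi;
    xi_vector_field : vector_field xi;
    eta_one_form : one_form eta;
    met_riemannian : riemannian met }.

Section almost_contact_metric.
Context {R : realType} {E : normedModType R} {M : manifold E}.
Variable S : acm_data M.

Definition almost_contact_metric : Prop :=
  [/\ (forall p v, phi S p (phi S p v) = - v + eta S p v *: xi S p),
      (forall p, eta S p (xi S p) = 1) &
      (forall p u v, met S p (phi S p u) (phi S p v) =
                     met S p u v - eta S p u * eta S p v)].

Definition fundamental_form (p : M) (u v : E) : R := met S p u (phi S p v).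

Definition closed_eta : Prop := forall p u v, ext_d1 (eta S) p u v = 0.

Definition almost_cosymplectic : Prop :=
  [/\ almost_contact_metric, closed_eta &
      forall p u v z, ext_d2 fundamental_form p u v z = 0].

Definition almost_kenmotsu (alpha : R) : Prop :=
  [/\ alpha != 0, almost_contact_metric, closed_eta &
      forall p u v z, ext_d2 fundamental_form p u v z =
        2 * alpha * wedge12 (eta S) fundamental_form p u v z].

End almost_contact_metric.

Record cell (R : realType) := Cell {
  cell_manifold :> manifold 'rV[R]_3;
  cell_structure : acm_data cell_manifold;
  cell_acm : almost_contact_metric cell_structure;
  cell_closed : closed_eta cell_structure }.

Section near_eq.
Context {R : realType} {V W : normedModType R}.

Lemma near_eq_differentiable (f g : V -> W) (x : V) :
  (\near x, f x = g x) -> differentiable f x -> differentiable g x.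
Proof.
move=> fg df.
have fgx : f x = g x := nbhs_singleton fg.
have nfg : \forall z \near (0 : V), f (z + x) = g (z + x).
  by move: fg; rewrite (near_shift 0 x); apply: filterS => z /=; rewrite subr0.
have gd : g \o shift x = cst (g x) + 'd f x +o_ 0 id.
  apply/eqaddoP => _/posnumP[e]; near=> y.
  have -> : (g \o shift x - (cst (g x) + 'd f x)) y =
            (f \o shift x - (cst (f x) + 'd f x)) y.
    rewrite !fctE /= fgx; congr (_ - _); apply/esym.
    by near: y; exact: nfg.
  near: y.
  have [_ fd] := (diff_locallyP x f).1 df.
  by have /eqaddoP := fd; apply.
apply/diff_locallyP.
have c : continuous ('d f x) by exact: diff_continuous.
by rewrite (diff_unique c gd).
Unshelve. all: by end_near. Qed.

Lemma Cr_eq (r : nat) (U : set V) (f g : V -> W) : open U ->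
  (forall x, U x -> f x = g x) -> Cr r U f -> Cr r U g.
Proof.
move=> oU; elim: r f g => [|r IH] f g fg /=.
  move=> cf x Ux; apply: (@cvg_trans _ (f @ x)).
    apply: near_eq_cvg; near=> y; apply: fg; near: y.
    exact: open_nbhs_nbhs.
  by rewrite -(fg x Ux); exact: cf.
case=> df Df.
have nfg x : U x -> \near x, f x = g x.
  by move=> Ux; near=> y; apply: fg; near: y; exact: open_nbhs_nbhs.
split=> [x Ux|v]; first exact: near_eq_differentiable (nfg x Ux) (df x Ux).
by apply: IH (Df v) => x Ux; exact: near_eq_derive (nfg x Ux).
Unshelve. all: by end_near. Qed.

End near_eq.

Section product.
Context {R : realType} {k n : nat}.

Definition row_box (U : 'I_k -> set 'rV[R]_n) : set 'M[R]_(k, n) :=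
  [set x | forall i, U i (row i x)].

Definition row_map (F : 'I_k -> 'rV[R]_n -> 'rV[R]_n) (x : 'M[R]_(k, n))
  : 'M[R]_(k, n) := \matrix_(i, j) F i (row i x) 0 j.

Lemma mx_continuous_at (T : topologicalType) (m p : nat)
    (f : T -> 'M[R]_(m, p)) (x : T) :
  (forall i j, {for x, continuous (fun y => f y i j)}) -> {for x, continuous f}.
Proof.
move=> cf A [P Px PA]; rewrite nbhs_filterE /=.
have : \forall y \near x, forall ij : 'I_m * 'I_p, P ij.1 ij.2 (f y ij.1 ij.2).
  by apply: filter_forall => -[i j] /=; apply: (cf i j); exact: Px.
by apply: filterS => y Py; apply: PA => i j; exact: (Py (i, j)).
Qed.

Lemma row_continuous (i : 'I_k) : continuous (@row R k n i).
Proof.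
move=> x; apply: mx_continuous_at => a j.
rewrite (_ : (fun _ => _) = (fun y : 'M[R]_(k, n) => y i j)).
  exact: coord_continuous.
by apply/funext => y; rewrite mxE.
Qed.

Lemma open_row_box (U : 'I_k -> set 'rV[R]_n) :
  (forall i, open (U i)) -> open (row_box U).
Proof.
move=> oU; rewrite openE => x Ux.
have Fx i : nbhs x (row i @^-1` U i).
  by apply: row_continuous; apply: open_nbhs_nbhs; split.
by apply: filterS (filter_forall _ Fx) => y Uy.
Qed.

Local Notation row_embed i := (mulmx (delta_mx i 0 : 'cV[R]_k)).

Lemma row_embedE (i : 'I_k) (w : 'rV[R]_n) (a : 'I_k) (j : 'I_n) :
  row_embed i w a j = (w 0 j) *+ (a == i).
Proof. by rewrite mxE big_ord1 mxE eqxx andbT mulr_natl. Qed.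

Lemma row_embed_continuous i :
  continuous (row_embed i : 'rV[R]_n -> 'M[R]_(k, n)).
Proof.
move=> w; apply: mx_continuous_at => a j.
rewrite (_ : (fun _ => _) = (fun y : 'rV[R]_n => y 0 j) \* cst ((a == i)%:R)).
  by apply: continuousM; [exact: coord_continuous|exact: cst_continuous].
by apply/funext => y; rewrite row_embedE /= mulr_natr.
Qed.

Lemma row_mapE F : row_map F = \sum_i (row_embed i \o F i \o row i).
Proof.
apply/funext => x; rewrite fct_sumE; apply/matrixP => a j.
rewrite summxE mxE (bigD1 a) //= row_embedE eqxx mulr1n big1 ?addr0 // => i ia.
by rewrite row_embedE eq_sym (negbTE ia).
Qed.

Lemma row_map_diff F x : (forall i, differentiable (F i) (row i x)) ->
  differentiable (row_map F) x /\
  forall v, 'D_v (row_map F) x = row_map (fun i w => 'D_w (F i) (row i x)) v.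
Proof.
move=> dF.
have dr i y : differentiable (@row R k n i) y.
  by apply: linear_differentiable; exact: row_continuous.
have de i y : differentiable (row_embed i : 'rV[R]_n -> 'M[R]_(k, n)) y.
  by apply: linear_differentiable; exact: row_embed_continuous.
have dfe i : differentiable (row_embed i \o F i) (row i x).
  exact: differentiable_comp.
have dc i : differentiable (row_embed i \o F i \o row i) x.
  exact: differentiable_comp.
split; first by rewrite row_mapE; exact: differentiable_sum.
move=> v; rewrite row_mapE derive_sum; last first.
  by move=> i; exact: diff_derivable.
rewrite row_mapE fct_sumE; apply: eq_bigr => i _.
rewrite deriveE // diff_comp // diff_comp //=.
rewrite (diff_lin _ (@row_embed_continuous i)) (diff_lin _ (@row_continuous i)).
by rewrite deriveE.
Qed.

Lemma row_map_Cr r (U : 'I_k -> set 'rV[R]_n) F : (forall i, open (U i)) ->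
  (forall i, Cr r (U i) (F i)) -> Cr r (row_box U) (row_map F).
Proof.
move=> oU; elim: r F => [|r IH] F /= CF.
  move=> x Ux; apply: mx_continuous_at => i j.
  rewrite (_ : (fun _ => _) = (fun w : 'rV[R]_n => w 0 j) \o F i \o row i).
    apply: continuous_comp; first exact: row_continuous.
    apply: continuous_comp; last exact: coord_continuous.
    exact: (CF i _ (Ux i)).
  by apply/funext => y; rewrite /row_map mxE.
have dF x : row_box U x -> forall i, differentiable (F i) (row i x).
  by move=> Ux i; exact: (CF i).1 _ (Ux i).
split=> [x /dF /row_map_diff[] //|v].
apply: (@Cr_eq _ _ _ _ _ (row_map (fun i => 'D_(row i v) (F i)))).
- exact: open_row_box.
- by move=> x /dF /row_map_diff[_ ->]; apply/matrixP => i j; rewrite !mxE.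
- by apply: IH => i; exact: (CF i).2.
Qed.

End product.

Section product_manifold.
Context {R : realType} {k n : nat}.

Section topology.
Variable K : 'I_k -> topologicalType.
Local Notation PK := (prod_topology K).

Definition box (U : forall i, set (K i)) : set PK := [set p | forall i, U i (p i)].

Lemma open_box U : (forall i, open (U i)) -> open (box U).
Proof.
move=> oU; rewrite openE => p Up.
have Fp i : nbhs p (@proj _ K i @^-1` U i).
  by apply: proj_continuous; apply: open_nbhs_nbhs; split => //; exact: Up.
by apply: filterS (filter_forall _ Fp) => q Uq.
Qed.

Lemma nbhs_box (p : PK) (A : set PK) : nbhs p A ->
  exists2 U : forall i, set (K i), (forall i, nbhs (p i) (U i)) & box U `<=` A.
Proof.
pose F : set_system PK := filter_from
  [set U : forall i, set (K i) | forall i, nbhs (p i) (U i)] box.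
have FF : Filter F.
  apply: filter_from_filter; first by exists (fun i => setT) => i; exact: filterT.
  move=> U V Up Vp; exists (fun i => U i `&` V i).
    by move=> i; exact: filterI.
  by move=> q UVq; split => i; have [] := UVq i.
suff : F --> p by move=> Fp /Fp.
apply/cvg_sup => i A' [_ [[B oB <-] Bp] BA']; rewrite nbhs_filterE.
exists (fun j => [set q : K j | forall e : j = i, B (ecast j (K j) e q)]).
  move=> j; have [ji|ji] := pselect (j = i).
    subst j; apply: (@filterS _ _ _ B).
      by move=> q Bq /= e; rewrite (eq_irrelevance e erefl).
    exact: open_nbhs_nbhs.
  by apply: filterS filterT => q _ /= e; case: (ji e).
by move=> q Bq; apply: BA'; exact: (Bq i erefl).
Qed.

Lemma continuous_to_prod (T : topologicalType) (f : T -> PK) (x : T) :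
  (forall i, {for x, continuous (fun y => f y i)}) -> {for x, continuous f}.
Proof.
move=> cf A /nbhs_box[U Up UA]; rewrite nbhs_filterE /=.
have Fx i : nbhs x [set y | U i (f y i)] by apply: (cf i); exact: Up.
by apply: filterS (filter_forall _ Fx) => y Uy; exact: UA.
Qed.

Lemma second_countable_prod :
  (forall i, @second_countable (K i)) -> @second_countable PK.
Proof.
move=> sK.
have /(_ _)/cid-/all_sig[B BK] : forall i, exists B : set (set (K i)), countable B /\ basis B.
  by move=> i; have [B] := sK i; exists B.
have /(_ _)/cid-/all_sig[e eB] : forall i, exists e : nat -> set (K i),
    forall U, B i U -> exists m, e m = U.
  move=> i; have /countable_injP[f finj] := (BK i).1.
  exists (fun m => xget set0 [set U | B i U /\ f U = m]) => U BU.
  exists (f U); case: xgetP => [V _ [BV fVU]|/(_ U)/not_andP[]//].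
  by apply: finj => //; exact/mem_set.
pose b (t : {ffun 'I_k -> nat}) := box (fun i => e i (t i)).
exists (b @` [set t : {ffun 'I_k -> nat} | forall i, B i (e i (t i))]).
  by apply: (sub_countable (card_image_le _ _)); exact: countableP.
split=> [_ [t Bt <-]|p A /nbhs_box[U Up UA]].
  by apply: open_box => i; exact: (BK i).2.1 _ (Bt i).
have /(_ _)/cid-/all_sig[m Hm] : forall i, exists m, [/\ B i (e i m), e i m (p i) &
    e i m `<=` U i].
  move=> i; have [V [BV Vp] VU] := (BK i).2.2 (p i) _ (Up i).
  by have [m mV] := eB i V BV; exists m; rewrite mV.
exists (b [ffun i => m i]).
  split; last by move=> i; rewrite ffunE; have [] := Hm i.
  by exists [ffun i => m i] => // i; rewrite ffunE; have [] := Hm i.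
move=> q bq; apply: UA => i; have [_ _] := Hm i; apply.
by have := bq i; rewrite ffunE.
Qed.

End topology.

Variable C : 'I_k -> manifold 'rV[R]_n.
Local Notation PC := (prod_topology (fun i => C i : topologicalType)).

Section product_chart.
Variable a : forall i, chart 'rV[R]_n (C i).

Definition prod_cfun (p : PC) : 'M[R]_(k, n) := \matrix_(i, j) a i (p i) 0 j.

Definition prod_cinv (x : 'M[R]_(k, n)) : PC := fun i => cinv (a i) (row i x).

Definition prod_cdom : set PC := box (fun i => cdom (a i)).

Lemma row_prod_cfun i p : row i (prod_cfun p) = a i (p i).
Proof. by apply/rowP => j; rewrite !mxE. Qed.

Lemma prod_cfun_image (U : forall i, set (C i)) :
  prod_cfun @` box U = row_box (fun i => a i @` U i).
Proof.
apply/seteqP; split => [_ [p Up <-] i|x Ux].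
  by rewrite row_prod_cfun; exists (p i).
have /(_ _)/cid-/all_sig : forall i, exists p : C i, U i p /\ a i p = row i x.
  by move=> i; have [p ? ?] := Ux i; exists p.
case=> p Hp; exists p; first by move=> i; have [] := Hp i.
by apply/row_matrixP => i; rewrite row_prod_cfun; have [] := Hp i.
Qed.

Lemma prod_cdom_open : open prod_cdom.
Proof. by apply: open_box => i; exact: cdom_open. Qed.

Lemma prod_codm_open : open (prod_cfun @` prod_cdom).
Proof. by rewrite prod_cfun_image; apply: open_row_box => i; exact: codm_open. Qed.

Lemma prod_cfunK p : prod_cdom p -> prod_cinv (prod_cfun p) = p.
Proof.
move=> ap; apply: functional_extensionality_dep => i.
by rewrite /prod_cinv row_prod_cfun cfunK.
Qed.

Lemma prod_cfun_continuous p : prod_cdom p -> {for p, continuous prod_cfun}.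
Proof.
move=> ap; apply: mx_continuous_at => i j.
rewrite (_ : (fun _ => _) =
  (fun w : 'rV[R]_n => w 0 j) \o a i \o @proj _ (fun i => C i : topologicalType) i).
  apply: continuous_comp; first exact: proj_continuous.
  apply: continuous_comp; last exact: coord_continuous.
  by apply: cfun_continuous; exact: ap.
by apply/funext => q; rewrite /prod_cfun mxE.
Qed.

Lemma prod_cinv_continuous x :
  (prod_cfun @` prod_cdom) x -> {for x, continuous prod_cinv}.
Proof.
rewrite prod_cfun_image => ax; apply: continuous_to_prod => i.
rewrite (_ : (fun _ => _) = cinv (a i) \o row i) //.
apply: continuous_comp; first exact: row_continuous.
by apply: cinv_continuous; exact: ax.
Qed.

Definition prod_chart : chart 'M[R]_(k, n) PC :=
  Chart prod_cdom_open prod_codm_open prod_cfunK prod_cfun_continuous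
    prod_cinv_continuous.

End product_chart.

Definition prod_atlas : set (chart 'M[R]_(k, n) PC) :=
  prod_chart @` [set a | forall i, atlas (a i)].

Definition prod_chart_at (p : PC) : chart 'M[R]_(k, n) PC :=
  prod_chart (fun i => chart_at (p i)).

Lemma prod_atlas_chart_at p : prod_atlas (prod_chart_at p).
Proof.
by exists (fun i => chart_at (p i)) => // i; exact: atlas_chart_at.
Qed.

Lemma prod_cdom_chart_at p : cdom (prod_chart_at p) p.
Proof. by move=> i; exact: cdom_chart_at. Qed.

Lemma prod_atlas_smooth a b : prod_atlas a -> prod_atlas b ->
  smooth_on (a @` (cdom a `&` cdom b)) (b \o cinv a).
Proof.
move=> [a' aa <-] [b' ab <-] r.
rewrite (_ : _ \o _ = row_map (fun i => b' i \o cinv (a' i))); last first.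
  by apply/funext => x; apply/matrixP => i j; rewrite !mxE.
rewrite (_ : _ @` _ =
  row_box (fun i => a' i @` (cdom (a' i) `&` cdom (b' i)))); last first.
  rewrite -prod_cfun_image; congr (_ @` _).
  by apply/seteqP; split=> p => [[ap bp] i|abp]; [split|split => i; have [] := abp i].
apply: row_map_Cr => i; last exact: atlas_smooth.
rewrite (_ : _ @` _ = codm (a' i) `&` cinv (a' i) @^-1` cdom (b' i)); last first.
  apply/seteqP; split => [_ [p [ap bp] <-]|x [[p ap <-]] /=].
    by split; [exists p|rewrite /= cfunK].
  by rewrite cfunK // => bp; exists p.
rewrite openE => x [ax bx]; apply: filterI.
  by apply: open_nbhs_nbhs; split => //; exact: codm_open.
apply: (cinv_continuous ax); apply: open_nbhs_nbhs; split => //.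
exact: cdom_open.
Qed.

Definition prod_manifold : manifold 'M[R]_(k, n) :=
  @Manifold R 'M[R]_(k, n) PC
    (hausdorff_product (fun i => @m_hausdorff _ _ (C i)))
    (second_countable_prod (fun i => @m_second_countable _ _ (C i)))
    prod_atlas prod_chart_at prod_atlas_chart_at prod_cdom_chart_at
    prod_atlas_smooth.

End product_manifold.

Section integral_submanifolds.
Context {R : realType} {E F : normedModType R}.

(* [N] is an injectively immersed manifold: its topology may be finer than the
   one induced by [M], as for the leaves of a foliation. *)
Definition integral_submanifold (M : manifold E) (D : M -> set E)
    (N : manifold F) (iota : N -> M) : Prop :=
  [/\ smooth_map iota, injective iota,
      (forall q, injective (tangent_map iota q)) &
      (forall q, range (tangent_map iota q) = D (iota q))].

Definition connected_integral_submanifold (M : manifold E) (D : M -> set E)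
    (N : manifold F) (iota : N -> M) : Prop :=
  [/\ integral_submanifold D iota, connected [set: N] & [set: N] !=set0].

Definition maximal_integral_submanifold (M : manifold E) (D : M -> set E)
    (N : manifold F) (iota : N -> M) : Prop :=
  connected_integral_submanifold D iota /\
  forall (N' : manifold F) (iota' : N' -> M),
    connected_integral_submanifold D iota' ->
    range iota `<=` range iota' -> range iota' `<=` range iota.

End integral_submanifolds.

Section sewed_cells.
Context {R : realType} {k : nat}.
Variable C : 'I_k -> cell R.

Definition cell_product : manifold 'M[R]_(k, 3) :=
  prod_manifold (fun i => C i : manifold 'rV[R]_3).

Definition cell_proj (i : 'I_k) (p : cell_product) : C i := p i.

Local Notation E := 'M[R]_(k, 3).
Local Notation dproj i p := (tangent_map (cell_proj i) p).

Definition factor_dist (i : 'I_k) (p : cell_product) : set E :=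
  [set v | forall j, j != i -> dproj j p v = 0].

Definition lift_vect (i : 'I_k) (p : cell_product) (w : 'rV[R]_3) : E :=
  xget 0 [set v | factor_dist i p v /\ dproj i p v = w].

Lemma dprojE (i : 'I_k) (p : cell_product) (v : E) : dproj i p v = row i v.
Proof.
rewrite /tangent_map (_ : _ \o _ =
  (chart_at (p i) \o cinv (chart_at (p i))) \o row i); last by apply/funext.
set G := chart_at (p i) \o _; set x := chart_at p p.
have Gx : \forall y \near row i x, y = G y.
  have : nbhs (row i x) (codm (chart_at (p i))).
    apply: open_nbhs_nbhs; split; first exact: codm_open.
    by exists (p i); [exact: cdom_chart_at|rewrite row_prod_cfun].
  by apply: filterS => _ [q qd <-]; rewrite /G /= cfunK.
have rx : \forall y \near x, row i y = (G \o row i) y.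
  exact: (@row_continuous _ _ _ i x) _ Gx.
rewrite -(near_eq_derive v rx) deriveE; last first.
  by apply: linear_differentiable; exact: row_continuous.
by rewrite (diff_lin _ (@row_continuous _ _ _ i)).
Qed.

Lemma lift_vectP (i : 'I_k) (p : cell_product) (w : 'rV[R]_3) (v : E) :
  factor_dist i p v /\ dproj i p v = w <-> v = lift_vect i p w.
Proof.
pose v0 : E := \matrix_(a, j) (w 0 j *+ (a == i)).
have uniq u : factor_dist i p u /\ dproj i p u = w -> u = v0.
  move=> [ui uw]; apply/row_matrixP => a.
  have [->|ai] := eqVneq a i.
    by rewrite -(dprojE _ p) uw; apply/rowP => j; rewrite !mxE eqxx.
  by rewrite -(dprojE _ p) ui //; apply/rowP => j; rewrite !mxE (negbTE ai).
have v0P : factor_dist i p v0 /\ dproj i p v0 = w.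
  split=> [a ai|]; rewrite dprojE; apply/rowP => j; rewrite !mxE ?eqxx //.
  by rewrite (negbTE ai).
have -> : lift_vect i p w = v0.
  by apply: uniq; rewrite /lift_vect; case: xgetP => [y _ //|/(_ v0)[]].
by split=> [/uniq//|->].
Qed.

Definition lift_field (i : 'I_k) (X : C i -> 'rV[R]_3) (p : cell_product) : E :=
  lift_vect i p (X (p i)).

(* Vanishes on [factor_dist j] for j != i, because [dproj i] does, and sends
   the lift of [w] to the lift of [phi w]. *)
Definition bar_phi (i : 'I_k) (p : cell_product) (v : E) : E :=
  lift_vect i p (phi (cell_structure (C i)) (p i) (dproj i p v)).

Definition sew_f (p : cell_product) (v : E) : E := \sum_i bar_phi i p v.

Definition bar_g (p : cell_product) (u v : E) : R :=
  \sum_i met (cell_structure (C i)) (p i) (dproj i p u) (dproj i p v).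

Definition bar_eta (i : 'I_k) (p : cell_product) (v : E) : R :=
  eta (cell_structure (C i)) (p i) (dproj i p v).

Definition bar_xi (p : cell_product) : E :=
  (Num.sqrt k%:R)^-1 *: \sum_i lift_field (xi (cell_structure (C i))) p.

Definition sew_dist (p : cell_product) : set E :=
  [set v | exists u t, v = sew_f p u + t *: bar_xi p].

Definition sewed_cells (N : manifold 'rV[R]_(2 * k).+1)
    (iota : N -> cell_product) : Prop :=
  maximal_integral_submanifold sew_dist iota.

(* The structure induced on [N]; [i0] is the index of the first cell. *)
Definition sewed_structure (i0 : 'I_k) (N : manifold 'rV[R]_(2 * k).+1)
    (iota : N -> cell_product) (S : acm_data N) : Prop :=
  [/\ (forall q v, tangent_map iota q (phi S q v) =
                   sew_f (iota q) (tangent_map iota q v)),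
      (forall q, tangent_map iota q (xi S q) = bar_xi (iota q)),
      (forall q v, eta S q v =
         Num.sqrt k%:R * bar_eta i0 (iota q) (tangent_map iota q v)) &
      (forall q u v, met S q u v =
         bar_g (iota q) (tangent_map iota q u) (tangent_map iota q v))].

End sewed_cells.

(* Main.v *)
(* With h_i : N -> C_i the component of the inclusion in the i-th cell, the
   fundamental form of N is the sum of the pullbacks by h_i of those of the
   cells, and its one-form is sqrt k times the pullback of eta_i, for every i:
   all the bar_eta_i agree on the distribution Im f + R bar_xi.  The exterior
   derivative commutes with pullbacks (by the symmetry of second derivatives in
   charts), so d eta = 0, and d Phi is the sum of the pullbacks of d Phi_i; in
   the Kenmotsu case each of these is
   2 alpha_0 (eta / sqrt k) /\ h_i^* Phi_i. *)
Require Import Defs.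
From HB Require Import structures.
From mathcomp Require Import all_boot all_order all_algebra.
From mathcomp Require Import all_classical all_reals all_analysis.
From mathcomp Require Import ring.

Set Implicit Arguments.
Unset Strict Implicit.
Unset Printing Implicit Defensive.

Import Order.TTheory GRing.Theory Num.Theory.
Import numFieldNormedType.Exports.

Local Open Scope classical_set_scope.
Local Open Scope ring_scope.

(* The unqualified name is that of [HB.structures.eta]. *)
Local Notation eta := Defs.eta.

(** * Bare functions with a proof of linearity *)

Lemma linear_at0 (R : pzRingType) (U V : lmodType R) (f : U -> V) :
  linear f -> f 0 = 0.
Proof. by move=> /(_ (-1) 0 0); rewrite !scaleN1r oppr0 addr0 addNr. Qed.

Lemma linear_opp_add (R : pzRingType) (U V : lmodType R) (f : U -> V) v c w :
  linear f -> f (- v + c *: w) = - f v + c *: f w.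
Proof.
move=> lf; rewrite addrC lf addrC; congr (_ + _).
by rewrite -[- v]addr0 -scaleN1r lf (linear_at0 lf) addr0 scaleN1r.
Qed.

(** * Mean value theorem and second differences along lines *)

Section calculus.
Context {R : realType} {V : normedModType R}.

Lemma nbhs_parallelogram (x u v : V) (A : set V) : nbhs x A ->
  exists2 s : R, 0 < s &
    forall a b, 0 <= a <= s -> 0 <= b <= s -> A (x + a *: u + b *: v).
Proof.
move=> /nbhs_ballP[e /= e0 eA].
have d0 : 0 < `|u| + `|v| + 1 by rewrite ltr_wpDl// addr_ge0.
(* The [+ 1] keeps the denominator positive when [u = v = 0] and makes the final bound strict. *)
exists (e / (`|u| + `|v| + 1)); first exact: divr_gt0.
move=> a b /andP[a0 ae] /andP[b0 be]; apply: eA; rewrite -ball_normE /=.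
rewrite -addrA opprD addNKr normrN.
rewrite (le_lt_trans (ler_normD _ _))// !normrZ !ger0_norm//.
apply: (@le_lt_trans _ _ (e / (`|u| + `|v| + 1) * (`|u| + `|v|))).
  by rewrite mulrDr lerD// ler_wpM2r.
by rewrite -mulrA gtr_pMr// mulrC ltr_pdivrMr// mul1r ltrDl.
Qed.

(** The difference quotients on both sides are the same function of [h]. *)
Lemma is_derive_line (f : V -> R) (x u : V) (t : R) :
  derivable f (x + t *: u) u ->
  is_derive t 1 (fun t : R => f (x + t *: u)) ('D_u f (x + t *: u)).
Proof.
have E : (fun h : R => h^-1 *: ((f (x + (h *: 1 + t) *: u)) - f (x + t *: u)))
    = (fun h : R => h^-1 *: ((f (h *: u + (x + t *: u))) - f (x + t *: u))).
  by apply/funext => h; rewrite -[h *: 1]/(h * 1) mulr1 scalerDl addrCA.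
move=> df; apply: DeriveDef; first by rewrite /derivable /= E.
by rewrite /derive /= E.
Qed.

Lemma MVT_line (f : V -> R) (x u : V) (s : R) : 0 < s ->
  (forall t, 0 <= t <= s -> derivable f (x + t *: u) u) ->
  exists2 c, 0 <= c <= s & f (x + s *: u) - f x = 'D_u f (x + c *: u) * s.
Proof.
move=> s0 df.
pose g t := f (x + t *: u); pose dg t := 'D_u f (x + t *: u).
have dgP t : 0 <= t <= s -> is_derive t 1 g (dg t).
  by move=> /df; exact: is_derive_line.
have [c cs gE] : exists2 c, c \in `[0, s]%R & g s - g 0 = dg c * (s - 0).
  apply: MVT_segment => //; first exact: ltW.
    by move=> t; rewrite in_itv /= => /andP[/ltW ? /ltW ?]; apply/dgP/andP.
  apply: derivable_within_continuous => t; rewrite in_itv /= => /dgP d.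
  exact: ex_derive.
exists c; first by rewrite in_itv in cs.
by move: gE; rewrite /g scale0r addr0 subr0.
Qed.

Lemma derivable_shift (f : V -> R) (a x u : V) :
  derivable f (x + a) u -> derivable (f \o shift a) x u.
Proof.
rewrite /derivable /= (_ : (fun h : R => _) =
  (fun h : R => h^-1 *: (f (h *: u + x + a) - f (x + a)))) //.
by apply/funext => h; rewrite addrA.
Qed.

Lemma derive_shift_comp (f : V -> R) (a x u : V) :
  'D_u (f \o shift a) x = 'D_u f (x + a).
Proof.
rewrite /derive /= (_ : (fun h : R => _) =
  (fun h : R => h^-1 *: (f (h *: u + (x + a)) - f (x + a)))) //.
by apply/funext => h; rewrite addrA.
Qed.

(** Mean value theorem twice: in direction [u] for [f (. + s v) - f], then in direction [v] for
    ['D_u f] from the point [x + a u] just found. *)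
Lemma second_difference (f : V -> R) (x u v : V) (s : R) : 0 < s ->
  (forall a b, 0 <= a <= s -> 0 <= b <= s ->
     derivable f (x + a *: u + b *: v) u /\
     derivable ('D_u f) (x + a *: u + b *: v) v) ->
  exists a b, [/\ 0 <= a <= s, 0 <= b <= s &
    f (x + s *: u + s *: v) - f (x + s *: u) - (f (x + s *: v) - f x) =
    'D_v ('D_u f) (x + a *: u + b *: v) * s * s].
Proof.
move=> s0 df.
have s_in : 0 <= s <= s by rewrite (ltW s0) lexx.
have z_in : (0 : R) <= 0 <= s by rewrite lexx (ltW s0).
have dg t : 0 <= t <= s ->
    derivable (f \o shift (s *: v)) (x + t *: u) u /\
    derivable f (x + t *: u) u.
  move=> ts; split; first by apply: derivable_shift; exact: (df t s ts s_in).1.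
  by have := (df t 0 ts z_in).1; rewrite scale0r addr0.
have [a as_ E] := @MVT_line (f \o shift (s *: v) - f) x u s s0
  (fun t ts => derivableB (dg t ts).1 (dg t ts).2).
have [b bs E'] := @MVT_line ('D_u f) (x + a *: u) v s s0
  (fun t ts => (df a t as_ ts).2).
exists a, b; split => //; rewrite -E' -derive_shift_comp.
have [d1 d2] := dg a as_.
by rewrite deriveB// in E; move: E; rewrite !fctE /= addrAC => <-.
Qed.

End calculus.

(** * Chain rule, symmetry of second derivatives and Leibniz rule *)

Section Cr_lemmas.
Context {R : realType}.
Implicit Types V W : normedModType R.

Lemma derive_comp V W W' (f : V -> W) (g : W -> W') (x v : V) :
  differentiable f x -> differentiable g (f x) ->
  'D_v (g \o f) x = 'D_('D_v f x) g (f x).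
Proof.
move=> df dg; rewrite deriveE; last exact: differentiable_comp.
by rewrite diff_comp //= !deriveE.
Qed.

Lemma derive_linear V W (f : V -> W) x : differentiable f x ->
  linear (fun v => 'D_v f x).
Proof. by move=> df c u v; rewrite !deriveE // linearP. Qed.

Lemma derive_comp_linear V W W' (L : {linear W -> W'}) (f : V -> W) x v :
  continuous L -> differentiable f x -> 'D_v (L \o f) x = L ('D_v f x).
Proof.
move=> cL df; rewrite derive_comp //; last exact: linear_differentiable.
by rewrite deriveE ?diff_lin //; exact: linear_differentiable.
Qed.

Lemma derive_coord V m n (f : V -> 'M[R]_(m, n)) x v i j :
  differentiable f x -> 'D_v (fun y => f y i j) x = 'D_v f x i j.
Proof.
by move=> df; rewrite derive_mx ?mxE //; exact: diff_derivable.
Qed.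

Lemma Cr_comp_linear V W W' (L : {linear W -> W'}) r (U : set V) (f : V -> W) :
  open U -> continuous L -> Cr r U f -> Cr r U (L \o f).
Proof.
move=> oU cL; elim: r f => [|r IH] f /=.
  by move=> cf x Ux; apply: continuous_comp; [exact: cf|exact: cL].
move=> [df Df]; split=> [x Ux|v].
  by apply: differentiable_comp; [exact: df|exact: linear_differentiable].
apply: (Cr_eq oU) (IH _ (Df v)) => x Ux.
by rewrite derive_comp_linear //; exact: df.
Qed.

Lemma Cr_coord V m n r (U : set V) (f : V -> 'M[R]_(m, n)) i j : open U ->
  Cr r U f -> Cr r U (fun x => f x i j : R^o).
Proof.
move=> oU; elim: r f => [|r IH] f /=.
  move=> cf x Ux; apply: (@continuous_comp _ _ _ f (fun M => M i j : R^o)).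
    exact: cf.
  exact: coord_continuous.
move=> [df Df]; split=> [x Ux|v].
  apply: (@differentiable_comp _ _ _ _ f (fun M => M i j : R^o)).
    exact: df.
  exact: differentiable_coord.
apply: (Cr_eq oU) (IH _ (Df v)) => x Ux.
by apply/esym/derive_coord; exact: df.
Qed.

(** Every clause of [Cr] is asked point by point, so it may be checked on a set that varies with the
    point. *)
Lemma Cr_local V W r (U : set V) (f : V -> W) :
  (forall x, U x -> exists2 A, A x & Cr r A f) -> Cr r U f.
Proof.
elim: r f => [|r IH] f /= Af.
  by move=> x /Af[A Ax cf]; exact: cf.
split=> [x /Af[A Ax [df _]]|v]; first exact: df.
by apply: IH => x /Af[A Ax [_ Df]]; exists A.
Qed.

(** If [F x] and [G x] were at distance d > 0, then near [x] a common value [F y = G z] would be at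
    distance less than d/2 from both. The points [y] and [z] are kept apart because two uses of the
    mean value theorem yield two unrelated points. *)
Lemma continuous_eq_at (T : topologicalType) (F G : T -> R) (x : T) :
  {for x, continuous F} -> {for x, continuous G} ->
  (forall A, nbhs x A -> exists y z, [/\ A y, A z & F y = G z]) -> F x = G x.
Proof.
move=> cF cG FG; apply/eqP/negPn/negP => ne.
have e0 : 0 < `|F x - G x| / 2 by rewrite divr_gt0// normr_gt0 subr_eq0.
have [y [z [[yF _] [_ zG] yz]]] : exists y z,
    [/\ `|F x - F y| < `|F x - G x| / 2 /\ `|G x - G y| < `|F x - G x| / 2,
        `|F x - F z| < `|F x - G x| / 2 /\ `|G x - G z| < `|F x - G x| / 2 &
        F y = G z].
  apply: (FG (fun y => _ /\ _)); near=> y; split; near: y.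
    by have /cvgrPdist_lt := cF; exact.
  by have /cvgrPdist_lt := cG; exact.
rewrite yz in yF.
have : `|F x - G x| < `|F x - G x| / 2 + `|F x - G x| / 2.
  apply: le_lt_trans (ltrD yF zG).
  rewrite -[X in _ <= _ + X]normrN; apply: le_trans (ler_normD _ _).
  by rewrite opprB addrA subrK.
by rewrite -splitr ltxx.
Unshelve. all: by end_near. Qed.

(** The second difference of [f] over a small parallelogram is symmetric in [u] and [v], and equals
    [s * s] times either mixed derivative at some point of the parallelogram. So the two continuous
    mixed derivatives take a common value arbitrarily near [x]. *)
Lemma schwarz_scalar V (U : set V) (f : V -> R^o) x u v : open U -> U x ->
  Cr 2 U f -> 'D_u (fun y => 'D_v f y) x = 'D_v (fun y => 'D_u f y) x.
Proof.
move=> oU Ux [df Df].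
have c w w' : {for x, continuous (fun y => 'D_w' (fun z => 'D_w f z) y)}.
  by have [_ /(_ w')] := Df w; exact.
apply: (@continuous_eq_at _ (fun y => 'D_u (fun z => 'D_v f z) y)
  (fun y => 'D_v (fun z => 'D_u f z) y)) => // A xA.
have : nbhs x (U `&` A) by apply: filterI => //; exact: open_nbhs_nbhs.
move=> /(nbhs_parallelogram u v)[s s0 UA].
have UA' a b : 0 <= a <= s -> 0 <= b <= s -> (U `&` A) (x + a *: v + b *: u).
  by move=> as_ bs; rewrite addrAC; exact: UA.
have [a [b [as_ bs E]]] := @second_difference _ _ f x u v s s0
  (fun a b as_ bs => let Uy := (UA a b as_ bs).1 in
    conj (diff_derivable (df _ Uy)) (diff_derivable ((Df u).1 _ Uy))).
have [b' [a' [bs' as' E']]] := @second_difference _ _ f x v u s s0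
  (fun a b as_ bs => let Uy := (UA' a b as_ bs).1 in
    conj (diff_derivable (df _ Uy)) (diff_derivable ((Df v).1 _ Uy))).
exists (x + b' *: v + a' *: u), (x + a *: u + b *: v).
split; [exact: (UA' _ _ bs' as').2|exact: (UA _ _ as_ bs).2|].
apply: (mulIf (lt0r_neq0 s0)); apply: (mulIf (lt0r_neq0 s0)).
rewrite -[LHS]E' -[RHS]E (addrAC x) !opprB addrACA [RHS]addrACA.
by rewrite (addrC (- _)).
Qed.

Lemma schwarz V m n (U : set V) (f : V -> 'M[R]_(m, n)) x u v :
  open U -> U x -> Cr 2 U f ->
  'D_u (fun y => 'D_v f y) x = 'D_v (fun y => 'D_u f y) x.
Proof.
move=> oU Ux Cf; apply/matrixP => i j; have [df Df] := Cf.
have E w w' : ('D_w (fun y => 'D_w' f y) x) i j =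
    'D_w (fun y => 'D_w' (fun z => f z i j : R^o) y) x.
  rewrite -derive_coord; last exact: (Df w').1.
  apply: near_eq_derive; near=> y.
  rewrite derive_coord //; apply: df; near: y; exact: open_nbhs_nbhs.
have S := schwarz_scalar u v oU Ux (Cr_coord i j oU Cf).
exact: etrans (E u v) (etrans S (esym (E v u))).
Unshelve. all: by end_near. Qed.

(** Expanding the second argument in the canonical basis turns [B y (L y)] into a finite sum of
    products of scalar functions. Linearity is asked only near [x], since local forms are linear
    only over the image of their chart. *)
Lemma leibniz_rule V n (B : V -> 'rV[R]_n -> R^o) (L : V -> 'rV[R]_n) (x : V) :
  (\forall y \near x, scalar (B y)) ->
  (forall v, differentiable (B ^~ v) x) -> differentiable L x ->
  differentiable (fun y => B y (L y) : R^o) x /\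
  forall u, 'D_u (fun y => B y (L y) : R^o) x =
    'D_u (B ^~ (L x)) x + B x ('D_u L x).
Proof.
move=> sB dB dL.
pose G (K : V -> 'rV[R]_n) : V -> R^o :=
  \sum_(j < n) ((fun y => K y 0 j : R^o) * B ^~ (delta_mx 0 j)).
have BE y v : scalar (B y) -> B y v = \sum_j v 0 j * B y (delta_mx 0 j).
  move=> sBy; pose M := GRing.isLinear.Build _ _ _ _ _ sBy.
  pose f : {scalar _} := HB.pack (B y) M.
  rewrite -[B y]/(f : _ -> _) {1}(row_sum_delta v) linear_sum.
  by apply: eq_bigr => j _; rewrite linearZ.
have GE (K : V -> 'rV[R]_n) : \forall y \near x, G K y = B y (K y).
  by apply: filterS sB => y sBy; rewrite BE // /G fct_sumE.
have dK (K : V -> 'rV[R]_n) j :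
    differentiable K x -> differentiable (fun y => K y 0 j : R^o) x.
  move=> dK.
  apply: (@differentiable_comp _ _ _ _ K (fun v : 'rV_n => v 0 j : R^o)) => //.
  exact: differentiable_coord.
have dG (K : V -> 'rV[R]_n) j : differentiable K x ->
    differentiable ((fun y => K y 0 j : R^o) * B ^~ (delta_mx 0 j)) x.
  by move=> /dK dKj; exact: differentiableM.
have DG (K : V -> 'rV[R]_n) u : differentiable K x -> 'D_u (G K) x =
    \sum_j (K x 0 j * 'D_u (B ^~ (delta_mx 0 j)) x +
      'D_u K x 0 j * B x (delta_mx 0 j)).
  move=> dKx; rewrite derive_sum; last by move=> j; exact/diff_derivable/dG.
  apply: eq_bigr => j _; rewrite deriveM; last 2 first.
  - exact/diff_derivable/dK.
  - exact/diff_derivable.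
  by rewrite derive_coord // [X in _ + X = _]mulrC.
split.
  apply: near_eq_differentiable (GE L) _.
  by apply: differentiable_sum => j; exact: dG.
move=> u; rewrite -(near_eq_derive u (GE L)) DG //.
(* The expansion for the constant map [L x] gives the term where only [B] is differentiated. *)
rewrite -(near_eq_derive u (GE (cst (L x)))) DG; last exact: differentiable_cst.
rewrite (BE x _ (nbhs_singleton sB)) -big_split /=; apply: eq_bigr => j _.
by rewrite derive_cst mxE mul0r addr0.
Qed.

End Cr_lemmas.

(** * Charts and coordinate expressions of smooth maps *)

Section charts.
Context {R : realType}.

Section open_image.
Context {E : normedModType R} {T : topologicalType}.
Variable a : chart E T.

Lemma chart_image_preimage (A : set T) :
  a @` (cdom a `&` A) = codm a `&` cinv a @^-1` A.
Proof.
apply/seteqP; split => [_ [p [ap Ap] <-]|_ [[p ap <-]] /=].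
  by split; [exists p|rewrite /= cfunK].
by rewrite cfunK // => Ap; exists p.
Qed.

Lemma open_chart_image (A : set T) : open A -> open (a @` (cdom a `&` A)).
Proof.
move=> oA; rewrite chart_image_preimage openE => x [ax Ax]; apply: filterI.
  by apply: open_nbhs_nbhs; split => //; exact: codm_open.
by apply: (cinv_continuous ax); apply: open_nbhs_nbhs.
Qed.

Lemma near_cinv (A : set T) p : cdom a p -> nbhs p A ->
  \forall x \near a p, A (cinv a x).
Proof.
move=> ap Ap; apply: (cinv_continuous (x := a p)); first by exists p.
by rewrite /= cfunK.
Qed.

End open_image.

Lemma cdom_nbhs (E : normedModType R) (T : topologicalType) (a : chart E T) p :
  cdom a p -> nbhs p (cdom a).
Proof. by move=> ap; apply: open_nbhs_nbhs; split => //; exact: cdom_open. Qed.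

Lemma smooth_map_id (E : normedModType R) (M : manifold E) :
  smooth_map (id : M -> M).
Proof.
by split=> [p A //|a b aa ab]; exact: atlas_smooth.
Qed.

Lemma smooth_rep_differentiable (E F : normedModType R) (M : manifold E)
    (N : manifold F) (h : M -> N) a b p : smooth_map h -> atlas a -> atlas b ->
  cdom a p -> cdom b (h p) -> differentiable (b \o h \o cinv a) (a p).
Proof.
move=> [_ sh] aa ab ap bp; have [dh _] := sh a b aa ab 1%N.
by apply: dh; exists p.
Qed.

(** Near [a p] the map [h] stays in the domain of [b], so [cinv b] undoes [b] there and the ordinary
    chain rule applies. Taking the identity for [h] or [k] gives the changes of chart. *)
Lemma derive_rep_comp (E F G : normedModType R) (M : manifold E)
    (N : manifold F) (P : manifold G) (h : M -> N) (k : N -> P) a b c p v :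
  smooth_map h -> smooth_map k -> atlas a -> atlas b -> atlas c ->
  cdom a p -> cdom b (h p) -> cdom c (k (h p)) ->
  'D_v (c \o (k \o h) \o cinv a) (a p) =
  'D_('D_v (b \o h \o cinv a) (a p)) (c \o k \o cinv b) (b (h p)).
Proof.
move=> sh sk aa ab ac ap bp cp.
have dh := smooth_rep_differentiable sh aa ab ap bp.
have dk := smooth_rep_differentiable sk ab ac bp cp.
have E1 : (b \o h \o cinv a) (a p) = b (h p) by rewrite /= cfunK.
rewrite -[in X in _ = X]E1 -derive_comp ?E1 //.
apply: near_eq_derive.
have : nbhs p (h @^-1` cdom b) by apply: sh.1; exact: cdom_nbhs.
move=> /(near_cinv ap); apply: filterS => x /= bx.
by rewrite cfunK.
Qed.

End charts.

(** * Tangent maps and changes of coordinates *)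

Section tangent.
Context {R : realType} {E : normedModType R} {M : manifold E}.

Lemma comp_from_linear (a : chart E M) p : atlas a -> cdom a p ->
  linear (comp_from a p).
Proof.
move=> aa ap; apply: derive_linear.
apply: (smooth_rep_differentiable (smooth_map_id M)) => //.
  exact: atlas_chart_at.
exact: cdom_chart_at.
Qed.

(** Chain rule for the identity composed with itself, from [chart_at p] through [a] back to
    [chart_at p]. *)
Lemma comp_inK (a : chart E M) p : atlas a -> cdom a p ->
  cancel (comp_in a p) (comp_from a p).
Proof.
move=> aa ap v.
have ac := @atlas_chart_at _ _ M p; have cp := @cdom_chart_at _ _ M p.
have := derive_rep_comp v (smooth_map_id M) (smooth_map_id M) ac aa ac cp ap cp.
rewrite -[RHS]/(comp_from a p (comp_in a p v)) => <-.
rewrite -[RHS](@derive_id R E (chart_at p p) v).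
apply: near_eq_derive.
have : nbhs (chart_at p p) (codm (chart_at p)).
  by apply: open_nbhs_nbhs; split; [exact: codm_open|exists p].
by apply: filterS => _ [q qd <-] /=; rewrite cfunK.
Qed.

Context {F : normedModType R} {N : manifold F}.
Variable h : M -> N.
Hypothesis sh : smooth_map h.

Lemma tangent_map_linear p : linear (tangent_map h p).
Proof.
apply: derive_linear; apply: smooth_rep_differentiable => //;
  by [exact: atlas_chart_at|exact: cdom_chart_at].
Qed.

(** Both sides differentiate [chart_at (h p) \o h \o cinv a]: the left one factors [h] as [h \o id]
    through [chart_at p], the right one as [id \o h] through [b]. *)
Lemma tangent_map_comp_from (a : chart E M) (b : chart F N) p v :
  atlas a -> atlas b -> cdom a p -> cdom b (h p) ->
  tangent_map h p (comp_from a p v) =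
  comp_from b (h p) ('D_v (b \o h \o cinv a) (a p)).
Proof.
move=> aa ab ap bp.
have ac := @atlas_chart_at _ _ M p; have cp := @cdom_chart_at _ _ M p.
have ac' := @atlas_chart_at _ _ N (h p).
have cp' := @cdom_chart_at _ _ N (h p).
rewrite -[RHS](derive_rep_comp v sh (smooth_map_id N)) //.
by rewrite -[LHS](derive_rep_comp v (smooth_map_id M) sh).
Qed.

End tangent.

(** * Pullbacks and local expressions of forms *)

Definition pullback1 (R : realType) (E F : normedModType R) (M : manifold E)
    (N : manifold F) (h : M -> N) (w : N -> F -> R) (p : M) (v : E) : R :=
  w (h p) (tangent_map h p v).

Definition pullback2 (R : realType) (E F : normedModType R) (M : manifold E)
    (N : manifold F) (h : M -> N) (w : N -> F -> F -> R) (p : M) (u v : E)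
    : R :=
  w (h p) (tangent_map h p u) (tangent_map h p v).

Section local_forms.
Context {R : realType} {E : normedModType R} {M : manifold E}.
Variables (a : chart E M) (aa : atlas a).

Lemma comp_from_codm_linear x : codm a x -> linear (comp_from a (cinv a x)).
Proof. by move=> [p ap <-]; rewrite cfunK //; exact: comp_from_linear. Qed.

Lemma local_form1_scalar (w : M -> E -> R) x : codm a x ->
  (forall p, scalar (w p)) -> scalar (local_form1 a w x).
Proof.
by move=> /comp_from_codm_linear lx lw c u v; rewrite /local_form1 lx lw.
Qed.

Lemma local_form2_scalarl (w : M -> E -> E -> R) x v : codm a x ->
  (forall p v, scalar (w p ^~ v)) -> scalar (local_form2 a w x ^~ v).
Proof.
by move=> /comp_from_codm_linear lx lw c u u'; rewrite /local_form2 lx lw.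
Qed.

Lemma local_form2_scalarr (w : M -> E -> E -> R) x u : codm a x ->
  (forall p u, scalar (w p u)) -> scalar (local_form2 a w x u).
Proof.
by move=> /comp_from_codm_linear lx lw c v v'; rewrite /local_form2 lx lw.
Qed.

End local_forms.

(** * Exterior derivatives of pullbacks *)

Section pullback.
Context {R : realType} {E : normedModType R} {n : nat}.
Context {M : manifold E} {N : manifold 'rV[R]_n}.
Variables (h : M -> N) (q : M).
Hypothesis sh : smooth_map h.

Local Notation a := (chart_at q).
Local Notation b := (chart_at (h q)).
Local Notation H := (b \o h \o cinv a : E -> 'rV[R]_n).
Local Notation T := (tangent_map h q).

Let U := a @` (cdom a `&` h @^-1` cdom b).

Let open_U : open U.
Proof.
apply: open_chart_image; apply: open_comp (cdom_open b) => p _.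
exact: sh.1.
Qed.

Let U_aq : U (a q).
Proof. by exists q => //; split; exact: cdom_chart_at. Qed.

Let near_U : \forall x \near a q, U x.
Proof. exact: open_nbhs_nbhs. Qed.

Let Cr_H r : Cr r U H.
Proof. by apply: sh.2; exact: atlas_chart_at. Qed.

Let H_aq : H (a q) = b (h q).
Proof. by rewrite /= cfunK //; exact: cdom_chart_at. Qed.

Let codm_H x : U x -> codm b (H x).
Proof. by move=> [p [ap bp] <-]; exists (h p); rewrite //= cfunK. Qed.

Let dH : differentiable H (a q).
Proof. exact: (Cr_H 1).1 _ U_aq. Qed.

Let dDH v : differentiable (fun x => 'D_v H x) (a q).
Proof. exact: ((Cr_H 2).2 v).1 _ U_aq. Qed.

Let DDHC u v :
  'D_u (fun x => 'D_v H x) (a q) = 'D_v (fun x => 'D_u H x) (a q).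
Proof. exact: (schwarz _ _ open_U U_aq (Cr_H 2)). Qed.

(** Lets the local expression of a pullback be written with the derivatives of [H] alone. The moving
    point [cinv a x] has its own chosen chart, whence the changes of coordinates. *)
Let pullback_comp_from x v : U x ->
  tangent_map h (cinv a x) (comp_from a (cinv a x) v) =
  comp_from b (cinv b (H x)) ('D_v H x) /\ h (cinv a x) = cinv b (H x).
Proof.
move=> [p [ap bp] <-]; have Ep := cfunK ap.
have -> : H (a p) = b (h p) by rewrite /= Ep.
rewrite Ep (cfunK bp); split; last exact: erefl.
by apply: tangent_map_comp_from => //; exact: atlas_chart_at.
Qed.

(** Near [a q] the local expression is [B x ('D_v H x)]. The Leibniz rule separates the derivative
    of the coefficients of [w], given by the chain rule, from a second derivative of [H]. *)
Lemma derive_pullback1 (w : N -> 'rV[R]_n -> R) u v :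
  (forall p, scalar (w p)) ->
  (forall v, differentiable (local_form1 b w ^~ v) (b (h q))) ->
  derivable (local_form1 a (pullback1 h w) ^~ v) (a q) u /\
  'D_u (local_form1 a (pullback1 h w) ^~ v) (a q) =
  'D_(T u) (local_form1 b w ^~ (T v)) (b (h q)) +
  local_form1 b w (b (h q)) ('D_u (fun x => 'D_v H x) (a q)).
Proof.
move=> sw dw.
have dwH z : differentiable (local_form1 b w ^~ z) (H (a q)) by rewrite H_aq.
pose B x z := local_form1 b w (H x) z.
have E1 : \forall x \near a q,
    B x ('D_v H x) = local_form1 a (pullback1 h w) x v.
  apply: filterS near_U => x /(pullback_comp_from v)[E1 E2].
  by rewrite /local_form1 /pullback1 E1 E2.
have sB : \forall x \near a q, scalar (B x).
  apply: filterS near_U => x Ux.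
  by apply: local_form1_scalar (codm_H Ux) sw; exact: atlas_chart_at.
have dB z : differentiable (B ^~ z) (a q).
  exact: differentiable_comp dH (dwH z).
have [dBH DBH] := leibniz_rule sB dB (dDH v).
split; first by apply: diff_derivable; exact: near_eq_differentiable E1 dBH.
rewrite -(near_eq_derive u E1) DBH.
have -> : 'D_u (B ^~ ('D_v H (a q))) (a q) = _ := derive_comp u dH (dwH _).
by rewrite /B H_aq.
Qed.

(** The second derivatives of [H] cancel by symmetry. *)
Lemma ext_d1_pullback (w : N -> 'rV[R]_n -> R) u v : one_form w ->
  ext_d1 (pullback1 h w) q u v = ext_d1 w (h q) (T u) (T v).
Proof.
move=> [sw cw].
have dw z : differentiable (local_form1 b w ^~ z) (b (h q)).
  have [dw _] := cw _ (atlas_chart_at (h q)) z 1%N.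
  by apply: dw; exists (h q) => //; exact: cdom_chart_at.
have cancel (A B A' B' c c' : R) :
    A = A' + c -> B = B' + c' -> c = c' -> A - B = A' - B'.
  by move=> -> -> ->; ring.
exact: cancel (derive_pullback1 u v sw dw).2 (derive_pullback1 v u sw dw).2
  (congr1 (local_form1 b w (b (h q))) (DDHC u v)).
Qed.

(** The Leibniz rule twice: [B1] freezes the second argument while the first one varies, and [B2]
    then lets the second one vary. *)
Lemma derive_pullback2 (w : N -> 'rV[R]_n -> 'rV[R]_n -> R) u v z :
  (forall p u, scalar (w p u)) -> (forall p v, scalar (w p ^~ v)) ->
  (forall u v, differentiable (fun y => local_form2 b w y u v) (b (h q))) ->
  derivable (fun x => local_form2 a (pullback2 h w) x v z) (a q) u /\
  'D_u (fun x => local_form2 a (pullback2 h w) x v z) (a q) =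
  'D_(T u) (fun y => local_form2 b w y (T v) (T z)) (b (h q)) +
  local_form2 b w (b (h q)) ('D_u (fun x => 'D_v H x) (a q)) (T z) +
  local_form2 b w (b (h q)) (T v) ('D_u (fun x => 'D_z H x) (a q)).
Proof.
move=> swr swl dw.
have dwH s t : differentiable (fun y => local_form2 b w y s t) (H (a q)).
  by rewrite H_aq.
pose B1 t x s := local_form2 b w (H x) s t.
pose B2 x t := local_form2 b w (H x) ('D_v H x) t.
have E1 : \forall x \near a q,
    B2 x ('D_z H x) = local_form2 a (pullback2 h w) x v z.
  apply: filterS near_U => x Ux.
  have [Ev E2] := pullback_comp_from v Ux.
  have [Ez _] := pullback_comp_from z Ux.
  by rewrite /local_form2 /pullback2 Ev Ez E2.
have sB1 t : \forall x \near a q, scalar (B1 t x).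
  apply: filterS near_U => x Ux.
  by apply: local_form2_scalarl (codm_H Ux) swl; exact: atlas_chart_at.
have dB1 t s : differentiable (B1 t ^~ s) (a q).
  exact: differentiable_comp dH (dwH s t).
have B1H t := leibniz_rule (sB1 t) (dB1 t) (dDH v).
have sB2 : \forall x \near a q, scalar (B2 x).
  apply: filterS near_U => x Ux.
  by apply: local_form2_scalarr (codm_H Ux) swr; exact: atlas_chart_at.
have [dBH DBH] := leibniz_rule sB2 (fun t => (B1H t).1) (dDH z).
split; first by apply: diff_derivable; exact: near_eq_differentiable E1 dBH.
rewrite -(near_eq_derive u E1) DBH (B1H _).2.
have -> : 'D_u (B1 ('D_z H (a q)) ^~ ('D_v H (a q))) (a q) = _ :=
  derive_comp u dH (dwH _ _).
by rewrite /B1 /B2 H_aq.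
Qed.

(** Six terms contain second derivatives of [H], and they cancel in pairs by symmetry. In the pair
    for [u] and [z] the second derivative sits once in each argument of [w], so antisymmetry is used
    as well. *)
Lemma ext_d2_pullback (w : N -> 'rV[R]_n -> 'rV[R]_n -> R) u v z :
  (forall p u, scalar (w p u)) -> (forall p u v, w p u v = - w p v u) ->
  (forall u v, differentiable (fun y => local_form2 b w y u v) (b (h q))) ->
  ext_d2 (pullback2 h w) q u v z = ext_d2 w (h q) (T u) (T v) (T z).
Proof.
move=> swr asw dw.
have swl p t : scalar (w p ^~ t).
  by move=> c s s'; rewrite /= asw swr opprD -mulrN -!asw.
have cancel (A B D A' B' D' c1 c2 c3 c4 c5 c6 : R) :
    A = A' + c1 + c2 -> B = B' + c3 + c4 -> D = D' + c5 + c6 ->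
    c1 = c3 -> c2 = - c5 -> c4 = c6 -> A - B + D = A' - B' + D'.
  by move=> -> -> -> -> -> ->; ring.
exact: cancel (derive_pullback2 u v z swr swl dw).2
  (derive_pullback2 v u z swr swl dw).2 (derive_pullback2 z u v swr swl dw).2
  (congr1 (fun s => local_form2 b w (b (h q)) s (T z)) (DDHC u v))
  (etrans (congr1 (local_form2 b w (b (h q)) (T v)) (DDHC u z)) (asw _ _ _))
  (congr1 (local_form2 b w (b (h q)) (T u)) (DDHC v z)).
Qed.

End pullback.

(** * Almost contact algebra and the fundamental form *)

(** From [f (f xi) = 0] the formula for the square at [f xi] gives [f xi = c *: xi] with
    [c = eta (f xi)]. Applying [f] again gives [c * c = 0]. Then computing the cube of [f] at [v] in
    two ways leaves [eta (f v) *: xi = 0]. *)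
Lemma almost_contact_kernel (R : fieldType) (V : lmodType R)
    (f : {linear V -> V}) (eta : {scalar V}) (xi : V) :
  (forall v, f (f v) = - v + eta v *: xi) -> eta xi = 1 ->
  f xi = 0 /\ forall v, eta (f v) = 0.
Proof.
move=> f2 exi.
have ff_xi : f (f xi) = 0 by rewrite f2 exi scale1r addNr.
have fxi : f xi = eta (f xi) *: xi.
  have /esym/eqP := f2 (f xi).
  by rewrite ff_xi linear0 addrC subr_eq0 => /eqP ->.
have fxi0 : f xi = 0.
  move: (eta (f xi)) fxi => c fxi; move: ff_xi.
  rewrite fxi linearZ /= fxi scalerA => /(congr1 eta).
  rewrite linearZ /= exi mulr1 linear0 => /eqP.
  by rewrite mulf_eq0 orbb => /eqP ->; rewrite scale0r.
split=> // v.
have := f2 (f v); rewrite (f2 v) linearD linearN linearZ /= fxi0 scaler0.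
by move=> /addrI /esym /(congr1 eta); rewrite linearZ /= exi mulr1 linear0.
Qed.

Section fundamental_form.
Context {R : realType}.

Section identities.
Context {E : normedModType R} {M : manifold E}.
Variable S : acm_data M.
Hypothesis acmS : almost_contact_metric S.

Let phi_xi_eta_phi p :
  phi S p (xi S p) = 0 /\ forall v, eta S p (phi S p v) = 0.
Proof.
have [phi2 exi _] := acmS.
pose f : {linear E -> E} :=
  HB.pack (phi S p) (GRing.isLinear.Build _ _ _ _ _ ((phi_affinor S).1 p)).
pose e : {scalar E} :=
  HB.pack (eta S p) (GRing.isLinear.Build _ _ _ _ _ ((eta_one_form S).1 p)).
exact: (@almost_contact_kernel _ _ f e _ (phi2 p) (exi p)).
Qed.

Lemma eta_phi p v : eta S p (phi S p v) = 0.
Proof. exact: (phi_xi_eta_phi p).2. Qed.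

Lemma fundamental_form_scalarl p v : scalar (fundamental_form S p ^~ v).
Proof.
by have [[_ ml _] _ _] := met_riemannian S; exact: ml.
Qed.

Lemma fundamental_form_scalarr p u : scalar (fundamental_form S p u).
Proof.
have [[mr _ _] _ _] := met_riemannian S => c v w.
by rewrite /fundamental_form (phi_affinor S).1 mr.
Qed.

(** Evaluate g(phi u, phi (phi v)) in two ways: compatibility of the metric gives g(u, phi v), and
    the formula for phi^2 gives - g(phi u, v), as g(phi u, xi) = eta(phi u) = 0. *)
Lemma fundamental_form_antisym p u v :
  fundamental_form S p u v = - fundamental_form S p v u.
Proof.
have [phi2 exi mphi] := acmS; have [[mr _ _] msym _] := met_riemannian S.
have met_xi w : met S p w (xi S p) = eta S p w.
  have := mphi p w (xi S p); rewrite (phi_xi_eta_phi p).1 exi mulr1.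
  by rewrite (linear_at0 (mr p _)) => /esym/eqP; rewrite subr_eq0 => /eqP.
have := mphi p u (phi S p v).
rewrite eta_phi mulr0 subr0 phi2 addrC mr met_xi eta_phi mulr0 add0r.
rewrite -/(fundamental_form S p u v) => <-.
have := mr p (phi S p u) (-1) v 0; rewrite addr0 scaleN1r mulN1r => ->.
by rewrite (linear_at0 (mr p _)) addr0 msym.
Qed.

End identities.

(** In a chart the form is the local metric evaluated on the local affinor, the intermediate changes
    of coordinates cancelling; the Leibniz rule applies. *)
Lemma fundamental_form_differentiable n (M : manifold 'rV[R]_n) (S : acm_data M)
    a x u v : atlas a -> codm a x ->
  differentiable (fun y => local_form2 a (fundamental_form S) y u v) x.
Proof.
move=> aa ax; have [[mr ml sm] _ _] := met_riemannian S.
have E1 : \forall y \near x,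
    local_form2 a (met S) y u (local_affinor a (phi S) y v) =
    local_form2 a (fundamental_form S) y u v.
  have /filterS : nbhs x (codm a).
    by apply: open_nbhs_nbhs; split => //; exact: codm_open.
  apply=> _ [p ap <-].
  by rewrite /local_form2 /local_affinor /fundamental_form comp_inK // cfunK.
apply: near_eq_differentiable E1 _.
apply: (@leibniz_rule _ _ _ (fun y => local_form2 a (met S) y u)
  (fun y => local_affinor a (phi S) y v) x _ _ _).1.
- have /filterS : nbhs x (codm a).
    by apply: open_nbhs_nbhs; split => //; exact: codm_open.
  by apply=> y ay; exact: local_form2_scalarr.
- by move=> w; exact: (sm _ aa u w 1%N).1.
- exact: ((phi_affinor S).2 _ aa v 1%N).1.
Qed.

End fundamental_form.

(** * Components of smooth maps into a product *)

Section maps_to_products.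
Context {R : realType} {k n : nat} {E : normedModType R}.
Context {C : 'I_k -> manifold 'rV[R]_n} {M : manifold E}.
Variable h : M -> prod_manifold C.
Hypothesis sh : smooth_map h.

(** Around [h p], the chart [b] of the [i]-th factor is completed to a product chart by the chosen
    charts of the other factors; the component read in [b] is then a row of [h]. The completion
    depends on [p], so smoothness is checked locally. *)
Lemma smooth_map_component (i : 'I_k) : smooth_map (fun p => h p i : C i).
Proof.
split=> [p|a b aa ab r].
  apply: (@continuous_comp _ _ _ h (fun q : prod_manifold C => q i)).
    exact: sh.1.
  exact: proj_continuous.
apply: Cr_local => _ [p [ap bp] <-].
pose c := dfwith (fun j => chart_at (h p j)) i b.
have ac : atlas (prod_chart c : chart _ (prod_manifold C)).
  exists c => // j; rewrite /c; case: dfwithP => // *; exact: atlas_chart_at.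
have cp : cdom (prod_chart c) (h p).
  move=> j; rewrite /c; case: dfwithP => // *; exact: cdom_chart_at.
exists (a @` (cdom a `&` h @^-1` cdom (prod_chart c))); first by exists p.
rewrite (_ : _ \o _ = row i \o (prod_chart c \o h \o cinv a)); last first.
  by apply/funext => x /=; rewrite row_prod_cfun /c dfwithin.
apply: Cr_comp_linear.
- apply: open_chart_image; apply: open_comp (cdom_open _) => q _.
  exact: sh.1.
- exact: row_continuous.
- exact: sh.2.
Qed.

Lemma row_tangent_map (i : 'I_k) q v :
  row i (tangent_map h q v) = tangent_map (fun p => h p i : C i) q v.
Proof.
have E1 : chart_at (h q i) \o (fun p => h p i) \o cinv (chart_at q) =
    row i \o (chart_at (h q) \o h \o cinv (chart_at q)).
  by apply/funext => x /=; rewrite row_prod_cfun.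
rewrite /tangent_map E1 derive_comp_linear //.
- exact: row_continuous.
- apply: smooth_rep_differentiable => //;
    by [exact: atlas_chart_at|exact: cdom_chart_at].
Qed.

End maps_to_products.

(** * Pointwise identities on the product of cells *)

Section cell_products.
Context {R : realType} {k : nat}.
Variable C : 'I_k -> cell R.
Local Notation Ci i := (cell_structure (C i)).
Implicit Types (p : cell_product C) (v : 'M[R]_(k, 3)).

(** Rows are the components in the cells; such row formulas reduce identities on the product to
    identities in each cell. *)
Lemma row_lift_vect i j p w : row j (lift_vect i p w) = w *+ (j == i).
Proof.
have [vi vw] := (lift_vectP i p w _).2 erefl.
rewrite -(dprojE _ p); have [->|ji] := eqVneq j i; first exact: vw.
exact: vi.
Qed.

Lemma row_sew_f i p v : row i (sew_f p v) = phi (Ci i) (p i) (row i v).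
Proof.
rewrite /sew_f linear_sum (bigD1 i) //= big1 ?addr0 => [|j ji].
  by rewrite row_lift_vect eqxx dprojE.
by rewrite row_lift_vect eq_sym (negbTE ji).
Qed.

Lemma row_bar_xi i p :
  row i (bar_xi p) = (Num.sqrt k%:R)^-1 *: xi (Ci i) (p i).
Proof.
rewrite /bar_xi linearZ linear_sum (bigD1 i) //= big1 ?addr0 => [|j ji].
  by rewrite row_lift_vect eqxx.
by rewrite row_lift_vect eq_sym (negbTE ji).
Qed.

Lemma bar_gE p u v : bar_g p u v = \sum_i met (Ci i) (p i) (row i u) (row i v).
Proof. by apply: eq_bigr => i _; rewrite !dprojE. Qed.

Lemma bar_etaE i p v : bar_eta i p v = eta (Ci i) (p i) (row i v).
Proof. by rewrite /bar_eta dprojE. Qed.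

(* Both sides vanish on the image of [sew_f] and are [1 / sqrt k] at
   [bar_xi]. *)
Lemma bar_eta_sew_dist i j p v : sew_dist p v -> bar_eta i p v = bar_eta j p v.
Proof.
move=> [u [t ->]]; suff H l :
    bar_eta l p (sew_f p u + t *: bar_xi p) = t * (Num.sqrt k%:R)^-1.
  by rewrite !H.
have [_ exi _] := cell_acm (C l).
rewrite bar_etaE addrC linearD linearZ /= row_sew_f row_bar_xi scalerA.
rewrite ((eta_one_form (Ci l)).1 (p l)) exi (eta_phi (cell_acm _)).
by rewrite mulr1 addr0.
Qed.

Lemma bar_g_sew_f p u v :
  bar_g p u (sew_f p v) =
  \sum_i fundamental_form (Ci i) (p i) (row i u) (row i v).
Proof. by rewrite bar_gE; apply: eq_bigr => i _; rewrite row_sew_f. Qed.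

Hypothesis k_gt0 : 0 < k%:R :> R.
Local Notation sqrtk := (Num.sqrt (k%:R : R)).

Lemma sqrtk_neq0 : sqrtk != 0.
Proof. by rewrite lt0r_neq0 // sqrtr_gt0. Qed.

Lemma bar_eta_bar_xi i p : sqrtk * bar_eta i p (bar_xi p) = 1.
Proof.
have [_ exi _] := cell_acm (C i); have sl := (eta_one_form (Ci i)).1 (p i).
rewrite bar_etaE row_bar_xi -[_ *: _]addr0 sl (linear_at0 sl) exi addr0 mulr1.
by rewrite mulfV // sqrtk_neq0.
Qed.

(** Row [j] produces the one-form of cell [j], which on [sew_dist] may be replaced by that of cell
    [i]; [sqrtk] cancels the normalisation of [bar_xi]. *)
Lemma sew_f_sew_f i p v : sew_dist p v ->
  sew_f p (sew_f p v) = - v + (sqrtk * bar_eta i p v) *: bar_xi p.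
Proof.
move=> pv; apply/row_matrixP => j; have [phi2 _ _] := cell_acm (C j).
rewrite !row_sew_f phi2 -bar_etaE (bar_eta_sew_dist j i pv).
rewrite linearD linearN linearZ /= row_bar_xi scalerA mulrAC.
by rewrite mulfV ?sqrtk_neq0 // mul1r.
Qed.

(** On [sew_dist] all [k] cells subtract the same product of one-forms, and [k] is the square of
    [sqrtk]. *)
Lemma bar_g_sew_f_sew_f i p u v : sew_dist p u -> sew_dist p v ->
  bar_g p (sew_f p u) (sew_f p v) =
  bar_g p u v - (sqrtk * bar_eta i p u) * (sqrtk * bar_eta i p v).
Proof.
move=> pu pv; rewrite !bar_gE.
have E j : met (Ci j) (p j) (row j (sew_f p u)) (row j (sew_f p v)) =
    met (Ci j) (p j) (row j u) (row j v) - bar_eta i p u * bar_eta i p v.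
  have [_ _ mphi] := cell_acm (C j).
  have eta_row w : sew_dist p w -> bar_eta i p w = eta (Ci j) (p j) (row j w).
    by move=> pw; rewrite -bar_etaE; exact: bar_eta_sew_dist.
  have -> := f_equal2 (met (Ci j) (p j)) (row_sew_f j p u) (row_sew_f j p v).
  have -> := f_equal2 *%R (eta_row u pu) (eta_row v pv).
  exact: mphi.
rewrite (eq_bigr _ (fun j _ => E j)) sumrB sumr_const card_ord.
by rewrite mulrACA -expr2 sqr_sqrtr ?ltW // mulr_natl.
Qed.

End cell_products.

(** * The structure induced on an integral submanifold *)

Section induced_structure.
Context {R : realType} {k : nat} (i0 : 'I_k) {C : 'I_k -> cell R}.
Context {N : manifold 'rV[R]_(2 * k).+1} {iota : N -> cell_product C}.
Variable S : acm_data N.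
Hypothesis iotaP : integral_submanifold (@sew_dist R k C) iota.
Hypothesis SP : sewed_structure i0 iota S.

Local Notation Ci i := (cell_structure (C i)).
Local Notation T := (tangent_map iota).
Local Notation sqrtk := (Num.sqrt (k%:R : R)).
Let h i (q : N) : C i := iota q i.

Let k_gt0 : 0 < k%:R :> R.
Proof. by rewrite ltr0n (leq_ltn_trans _ (ltn_ord i0)). Qed.

Let sqrtk0 : sqrtk != 0 := sqrtk_neq0 k_gt0.

Let smooth_h i : smooth_map (h i).
Proof. by case: iotaP => si _ _ _; exact: smooth_map_component. Qed.

Let row_T i q v : row i (T q v) = tangent_map (h i) q v.
Proof. by case: iotaP => si _ _ _; exact: row_tangent_map. Qed.

Let dist_T q v : sew_dist (iota q) (T q v).
Proof. by case: iotaP => _ _ _ /(_ q) <-; exists v. Qed.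

Let T_linear q : linear (T q).
Proof. by case: iotaP => si _ _ _; exact: tangent_map_linear. Qed.

(** Tangent vectors of [N] are mapped into [sew_dist], so the reference cell [i0] may be exchanged
    for any [i]. *)
Lemma sewed_eta i q v : eta S q v = sqrtk * pullback1 (h i) (eta (Ci i)) q v.
Proof.
case: SP => _ _ -> _; rewrite (bar_eta_sew_dist i0 i (dist_T q v)).
by rewrite bar_etaE row_T.
Qed.

Lemma sewed_fundamental_form q u v : fundamental_form S q u v =
  \sum_i pullback2 (h i) (fundamental_form (Ci i)) q u v.
Proof.
case: SP => Tphi _ _ Smet; rewrite /fundamental_form Smet Tphi bar_g_sew_f.
apply: eq_bigr => i _.
exact: (f_equal2 (fundamental_form (Ci i) (h i q)) (row_T i q u) (row_T i q v)).
Qed.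

(** The identities hold on [sew_dist]; the one between vectors is brought back to [N] by injectivity
    of the tangent map. *)
Lemma sewed_almost_contact_metric : almost_contact_metric S.
Proof.
case: (SP) => Tphi Txi Seta Smet; case: (iotaP) => _ _ Tinj _.
split=> [q v|q|q u v].
- apply: (Tinj q); rewrite !Tphi (sew_f_sew_f k_gt0 i0 (dist_T q v)).
  have -> := linear_opp_add v (eta S q v) (xi S q) (T_linear q).
  by rewrite Txi Seta.
- by rewrite Seta Txi bar_eta_bar_xi.
- by rewrite !Seta !Smet !Tphi (bar_g_sew_f_sew_f k_gt0 i0).
Qed.

Lemma ext_d1_sewed_eta i q u v : ext_d1 (eta S) q u v =
  sqrtk * ext_d1 (eta (Ci i)) (h i q) (tangent_map (h i) q u)
    (tangent_map (h i) q v).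
Proof.
rewrite -ext_d1_pullback //; last exact: eta_one_form.
have [se ce] := eta_one_form (Ci i).
have de z : differentiable (local_form1 (chart_at (h i q)) (eta (Ci i)) ^~ z)
    (chart_at (h i q) (h i q)).
  apply: (ce _ (atlas_chart_at (h i q)) z 1%N).1.
  by exists (h i q) => //; exact: cdom_chart_at.
have D w z : 'D_w (local_form1 (chart_at q) (eta S) ^~ z) (chart_at q q) =
    sqrtk * 'D_w (local_form1 (chart_at q) (pullback1 (h i) (eta (Ci i))) ^~ z)
      (chart_at q q).
  have [d _] := derive_pullback1 (smooth_h i) w z se de.
  have E : local_form1 (chart_at q) (eta S) ^~ z =
      sqrtk *: local_form1 (chart_at q) (pullback1 (h i) (eta (Ci i))) ^~ z.
    by apply/funext => x; exact: sewed_eta.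
  exact: etrans (congr1 (fun F : _ -> R^o => 'D_w F (chart_at q q)) E)
    (deriveZ sqrtk d).
exact: etrans (f_equal2 (fun x y => x - y) (D u v) (D v u))
  (esym (mulrBr _ _ _)).
Qed.

(** Each pulled back coefficient is derivable, so the derivative passes through the sum over the
    cells; the exterior derivative then commutes with each pullback. *)
Lemma ext_d2_sewed_fundamental_form q u v z :
  ext_d2 (fundamental_form S) q u v z =
  \sum_i ext_d2 (fundamental_form (Ci i)) (h i q) (tangent_map (h i) q u)
    (tangent_map (h i) q v) (tangent_map (h i) q z).
Proof.
have sr i := @fundamental_form_scalarr _ _ _ (Ci i).
have sl i := @fundamental_form_scalarl _ _ _ (Ci i).
have dPhi i s t : differentiable (fun y => local_form2 (chart_at (h i q))
    (fundamental_form (Ci i)) y s t) (chart_at (h i q) (h i q)).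
  apply: fundamental_form_differentiable; first exact: atlas_chart_at.
  by exists (h i q) => //; exact: cdom_chart_at.
have D w s t :
    'D_w (fun x => local_form2 (chart_at q) (fundamental_form S) x s t)
      (chart_at q q) =
    \sum_i 'D_w (fun x => local_form2 (chart_at q)
      (pullback2 (h i) (fundamental_form (Ci i))) x s t) (chart_at q q).
  have d i := (derive_pullback2 (smooth_h i) w s t (sr i) (sl i) (dPhi i)).1.
  have E : (fun x => local_form2 (chart_at q) (fundamental_form S) x s t) =
      \sum_i (fun x => local_form2 (chart_at q)
        (pullback2 (h i) (fundamental_form (Ci i))) x s t).
    by apply/funext => x; rewrite fct_sumE; exact: sewed_fundamental_form.
  exact: etrans (congr1 (fun F : _ -> R^o => 'D_w F (chart_at q q)) E)
    (derive_sum d).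
apply: etrans (f_equal2 +%R (f_equal2 (fun x y => x - y) (D u v z) (D v u z))
  (D z u v)) _.
rewrite -sumrB -big_split /=; apply: eq_bigr => i _.
apply: (ext_d2_pullback (smooth_h i) u v z (sr i) _ (dPhi i)).
exact: (fundamental_form_antisym (cell_acm (C i))).
Qed.

Lemma sewed_closed_eta : closed_eta S.
Proof.
by move=> q u v; rewrite (ext_d1_sewed_eta i0) cell_closed mulr0.
Qed.

(** Every pulled back one-form of a cell equals [sqrtk^-1] times that of [N], a factor common to the
    whole sum. This is the source of the constant [alpha0 / sqrt k]. *)
Lemma sewed_wedge q u v z :
  sqrtk^-1 * wedge12 (eta S) (fundamental_form S) q u v z =
  \sum_i wedge12 (eta (Ci i)) (fundamental_form (Ci i)) (h i q)
    (tangent_map (h i) q u) (tangent_map (h i) q v) (tangent_map (h i) q z).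
Proof.
have etaE i w :
    eta (Ci i) (h i q) (tangent_map (h i) q w) = sqrtk^-1 * eta S q w.
  by rewrite (sewed_eta i) mulKf.
pose F i s t := pullback2 (h i) (fundamental_form (Ci i)) q s t.
have scale (c x y t a b d a' b' d' : R) : a = c * a' -> b = c * b' ->
    d = c * d' -> a * x - b * y + d * t = c * (a' * x - b' * y + d' * t).
  by move=> -> -> ->; ring.
have cong (a b d x y t x' y' t' : R) : x = x' -> y = y' -> t = t' ->
    a * x - b * y + d * t = a * x' - b * y' + d * t'.
  by move=> -> -> ->.
have WS : wedge12 (eta S) (fundamental_form S) q u v z =
    eta S q u * (\sum_i F i v z) - eta S q v * (\sum_i F i u z) +
    eta S q z * (\sum_i F i u v).
  by apply: cong; exact: sewed_fundamental_form.
rewrite WS !mulr_sumr -sumrB -big_split mulr_sumr; apply: eq_bigr => i _.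
exact/esym/(scale _ _ _ _ _ _ _ _ _ _ (etaE i u) (etaE i v) (etaE i z)).
Qed.

End induced_structure.

Theorem theorem3 (R : realType) (k : nat) (hk : (2 <= k)%N) (C : 'I_k -> cell R)
    (N : manifold 'rV[R]_(2 * k).+1) (iota : N -> cell_product C)
    (hN : sewed_cells iota) (S : acm_data N)
    (hS : sewed_structure (Ordinal (ltnW hk)) iota S) :
  ((forall i, almost_cosymplectic (cell_structure (C i))) ->
     almost_cosymplectic S) /\
  (forall alpha0 : R, alpha0 != 0 ->
     (forall i, almost_kenmotsu (cell_structure (C i)) alpha0) ->
     almost_kenmotsu S (alpha0 / Num.sqrt k%:R)).
Proof.
have [[iotaP _ _] _] := hN.
have acmS := sewed_almost_contact_metric iotaP hS.
have clS := sewed_closed_eta iotaP hS.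
split=> [cosymC|alpha0 a0 kenC].
  split=> // q u v z.
  rewrite (ext_d2_sewed_fundamental_form iotaP hS) big1 // => i _.
  by have [_ _ ->] := cosymC i.
split=> // [|q u v z].
  by rewrite mulf_neq0 // invr_neq0 // lt0r_neq0 // sqrtr_gt0 ltr0n ltnW.
(* The regrouping isolates [(Num.sqrt k%:R)^-1 * wedge12], the left side of [sewed_wedge], behind
   the factor [2 * alpha0]. *)
rewrite (ext_d2_sewed_fundamental_form iotaP hS) mulrA -mulrA.
rewrite (sewed_wedge iotaP hS) mulr_sumr; apply: eq_bigr => i _.
by have [_ _ _ ->] := kenC i.
Qed.
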